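(* Let $\mathbb K$ be a field, let $\delta\in\mathbb K$, let $\mathcal M$ be a finite set with a distinguished element $v$, and let $\widehat{\mathcal{HB}}_{\check\omega_3}(\delta)$ be the coloured Brauer category with infinitesimal braids for $G_2$-representations defined in the context. If $I\neq0$ in $\widehat{\mathcal{HB}}_{\check\omega_3}(\delta)$ (where $I$ is the identity morphism of the object $v$), then $\delta=7$.
   Context: **Coloured Brauer diagrams.** Objects are finite, possibly empty, sequences of elements of $\mathcal M\ni v$; $v^r$ is $r$ copies of $v$. A coloured Brauer diagram from $\mathbf s$ to $\mathbf t$ is a perfect matching of bottom points (labelled left to right by $\mathbf s$) and top points (labelled by $\mathbf t$) such that matched points have the same colour and two points in the same row are matched only if their colour is $v$. Let $\mathcal C$ be the $\mathbb K$-linear strict monoidal category with these diagrams as a basis of $\mathrm{Hom}(\mathbf s,\mathbf t)$; $BA$ is obtained by stacking $B$ on top of $A$ and replacing each closed loop by $\delta$; $\otimes$ is concatenation/juxtaposition. $I(\mathbf s)$ is the identity, $I^a=I((a))$, $X_{a,b}:(a,b)\to(b,a)$ the crossing, $X(\mathbf s,\mathbf t):(\mathbf s,\mathbf t)\to(\mathbf t,\mathbf s)$ the crossing of two blocks of parallel strands, $I=I^v$, $X=X_{v,v}$, $\cap:(v,v)\to\emptyset$, $\cup:\emptyset\to(v,v)$, $E=\cup\cap$. **$\mathcal{HB}_{\check\omega_3}(\delta)$** is the $\mathbb K$-linear strict monoidal category obtained from $\mathcal C$ by freely adjoining morphisms (coupons) $\check\omega_3:\emptyset\to v^3$ and $\mathbb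 H(a,b):(a,b)\to(a,b)$ for $a,b\in\mathcal M$, subject to: (i) sliding: for each coupon $g:\mathbf s\to\mathbf t$ and object $\mathbf c$, $X(\mathbf c,\mathbf t)(I(\mathbf c)\otimes g)=(g\otimes I(\mathbf c))X(\mathbf c,\mathbf s)$ and $X(\mathbf t,\mathbf c)(g\otimes I(\mathbf c))=(I(\mathbf c)\otimes g)X(\mathbf s,\mathbf c)$; (ii) duality: $\mathbb H(v,v)$ is equal to its rotation by $180^\circ$ using nested cups and caps; (iii) $X_{b,a}\mathbb H(b,a)=\mathbb H(a,b)X_{b,a}$; (iv) $(I\otimes\cap\otimes I^a)(X\otimes\mathbb H(v,a))(I\otimes\cup\otimes I^a)=-\mathbb H(v,a)$ and $(I^a\otimes\cap\otimes I)(\mathbb H(a,v)\otimes X)(I^a\otimes\cup\otimes I)=-\mathbb H(a,v)$; (v) with $\mathbb H_{12}=\mathbb H(a,b)\otimes I^c$, $\mathbb H_{23}=I^a\otimes\mathbb H(b,c)$, $\mathbb H_{13}=(I^a\otimes X_{c,b})(\mathbb H(a,c)\otimes I^b)(I^a\otimes X_{b,c})$: $[\mathbb H_{12},\mathbb H_{13}+\mathbb H_{23}]=0=[\mathbb H_{12}+\mathbb H_{13},\mathbb H_{23}]$; (vi) $(X\otimes I)\check\omega_3=(I\otimes X)\check\omega_3=-\check\omega_3$. (Here $a,b,c$ range over $\mathcal M$.) Put $\Upsilon=(I\otimes I\otimes\cap)(\check\omega_3\otimes I):v\to v^2$ and $\hat\Upsilon=(I\otimes\cap)(\Upsilon\otimes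 I):v^2\to v$. **$\widehat{\mathcal{HB}}_{\check\omega_3}(\delta)$** is the quotient of $\mathcal{HB}_{\check\omega_3}(\delta)$ by the tensor ideal generated by $\hat\Upsilon\Upsilon-6I$ and $\mathbb H(v,v)-X+2E-I\otimes I+\Upsilon\hat\Upsilon$. *)

(* Defs.v *)
From HB Require Import structures.
From mathcomp Require Import all_boot all_algebra.
From mathcomp Require Import zify.

Set Implicit Arguments.
Unset Strict Implicit.
Unset Printing Implicit Defensive.

(* Two involutions [al], [be] without a common fixed point: in the graph     *)
(* with edges x -- al x and x -- be x, every connected component containing  *)
(* a fixed point (of [al] or [be]) contains exactly two of them.  This is    *)
(* what makes the stacking of two perfect matchings a perfect matching.      *)

Definition link (T : finType) (al be : T -> T) : rel T :=
  fun x y => (y == al x) || (y == be x).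

Section Dihedral.
Variables (T : finType) (al be : T -> T).
Hypotheses (alK : involutive al) (beK : involutive be).
Hypothesis no_fix : forall x, al x = x -> be x <> x.
Let si := be \o al.

Lemma link_sym : connect_sym (link al be).
Proof.
by apply: sym_connect_sym => x y; rewrite /link !(eq_sym y)
  (can2_eq alK alK) (can2_eq beK beK).
Qed.

Let si_inj : injective si.
Proof. exact: inj_comp (inv_inj beK) (inv_inj alK). Qed.

Lemma end_unique x : be x = x ->
  exists y, [/\ y != x, (al y == y) || (be y == y), connect (link al be) x y
    & forall z, z != x -> (al z == z) || (be z == z) ->
                connect (link al be) x z -> z = y].
Proof.
move=> bex; pose n := order si x.
have n0 : 0 < n by apply: order_gt0.
have nK : iter n si x = x by apply: iter_order.
have it_inj i j : i < n -> j < n -> iter i si x = iter j si x -> i = j.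
  by move=> Hi Hj eq_ij; rewrite -(findex_iter Hi) eq_ij findex_iter.
have iterI k : injective (iter k si).
  by elim: k => [|k IH] u w //= /si_inj /IH.
have al_it k : k < n -> al (iter k si x) = iter (n.-1 - k) si x.
  move=> Hk; apply: (iterI k.+1); rewrite -iterD.
  have -> : k.+1 + (n.-1 - k) = n by lia.
  rewrite nK; elim: k {Hk} => [|k IH]; first by rewrite /= /si /= alK.
  by rewrite iterSr iterS [si (al _)]/= /si /= alK beK.
have be_it k : 0 < k -> k < n -> be (iter k si x) = iter (n - k) si x.
  case: k => // k _ Hk; rewrite iterS {1}/si /= beK al_it; last by lia.
  by congr iter; lia.
have step k : connect (link al be) x (iter k si x).
  elim: k => [|k IH]; first exact: connect0.
  apply: (connect_trans IH); apply: (@connect_trans _ _ (al (iter k si x))).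
    by apply: connect1; rewrite /link eqxx.
  by apply: connect1; rewrite /link /= eqxx orbT.
have conn z : connect (link al be) x z -> exists2 k, k < n & z = iter k si x.
  case/connectP=> p; elim/last_ind: p z => [|p w IH] z.
    by move=> _ ->; exists 0.
  rewrite rcons_path last_rcons => /andP[Hp Hl] ->.
  have [k Hk Ek] := IH _ Hp erefl; move: Hl; rewrite Ek /link => /orP[] /eqP ->.
    by exists (n.-1 - k); [lia | apply: al_it].
  case: (posnP k) => [-> | k0]; first by exists 0.
  by exists (n - k); [lia | apply: be_it].
pose m := n./2.
have nE : n = odd n + m.*2 by rewrite odd_double_half.
exists (iter m si x).
have m0 : 0 < m.
  rewrite lt0n; apply/eqP => m0; have n1 : n = 1 by lia.
  by apply: (no_fix (x := x)) => //; have := al_it 0 n0; rewrite n1.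
split; last 1 first.
- move=> z zx /orP zfix /conn [k Hk Ez]; subst z.
  have k0 : 0 < k by case: k zx {Hk zfix} => //; rewrite eqxx.
  congr iter; case: zfix => /eqP.
    by rewrite al_it // => /it_inj; lia.
  by rewrite be_it // => /it_inj; lia.
- by apply/eqP=> /(@it_inj m 0); lia.
- case: (boolP (odd n)) => on; apply/orP; [left | right]; apply/eqP.
    by rewrite al_it; [congr iter; lia | lia].
  by rewrite be_it; [congr iter; lia | lia | lia].
- exact: step.
Qed.
End Dihedral.

Lemma link_end_unique (T : finType) (al be : T -> T) x :
  involutive al -> involutive be -> (forall x, al x = x -> be x <> x) ->
  (al x == x) || (be x == x) ->
  exists y, [/\ y != x, (al y == y) || (be y == y), connect (link al be) x y
    & forall z, z != x -> (al z == z) || (be z == z) ->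
                connect (link al be) x z -> z = y].
Proof.
move=> alK beK nf /orP[] /eqP fx; last exact: end_unique.
have nf' z : be z = z -> al z <> z by move=> bz az; exact: (nf z).
have [y [yx yf cxy yu]] := @end_unique _ be al beK alK nf' x fx.
have eqc : connect (link al be) =2 connect (link be al).
  by apply: eq_connect => u w; rewrite /link orbC.
exists y; split=> //; first by rewrite orbC.
  by rewrite eqc.
by move=> z zx zf; rewrite eqc; apply: yu => //; rewrite orbC.
Qed.

(* inl: bottom points, labelled by s; inr: top points, labelled by t. *)
Definition points (M : Type) (s t : seq M) : finType :=
  ('I_(size s) + 'I_(size t))%type.

Section Diagrams.
Variables (M : finType) (v : M).
Implicit Types s t u : seq M.

(* The default value [v] of [nth] is never used. *)
Definition colour s t (p : points s t) : M :=
  match p with inl i => nth v s i | inr j => nth v t j end.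

Definition is_bottom s t (p : points s t) : bool :=
  if p is inl _ then true else false.

(* A perfect matching is encoded as a fixed-point-free involution. *)
Definition is_brauer s t (f : {ffun points s t -> points s t}) : bool :=
  [forall p, [&& f (f p) == p, f p != p, colour (f p) == colour p
               & (is_bottom (f p) == is_bottom p) ==> (colour p == v)]].

Record diagram s t := Diagram {
  matching :> {ffun points s t -> points s t};
  _ : is_brauer matching }.

HB.instance Definition _ s t := [isSub for @matching s t].
HB.instance Definition _ s t := [Finite of diagram s t by <:].

Lemma brauerP s t (f : {ffun points s t -> points s t}) :
  reflect (forall p, [/\ f (f p) = p, f p <> p, colour (f p) = colour p
             & is_bottom (f p) = is_bottom p -> colour p = v])
          (is_brauer f).
Proof.
apply: (iffP forallP) => H p.
  have /and4P[/eqP ? /eqP ? /eqP ? /implyP h] := H p.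
  by split=> // /eqP Hb; apply/eqP/h.
have [? ? ? h] := H p; apply/and4P; split; do ?exact/eqP.
by apply/implyP=> /eqP Hb; apply/eqP/h.
Qed.

Lemma diagramP s t (D : diagram s t) p :
  [/\ D (D p) = p, D p <> p, colour (D p) = colour p
    & is_bottom (D p) = is_bottom p -> colour p = v].
Proof. by case: D => f fP; apply: (brauerP _ fP). Qed.

Definition glued s t u : finType := (points s t + 'I_(size u))%type.

Definition low_pt s t u (p : points s t) : glued s t u := inl p.
Definition high_pt s t u (p : points t u) : glued s t u :=
  match p with inl j => inl (inr j) | inr k => inr k end.
Definition outer_pt s t u (p : points s u) : glued s t u :=
  match p with inl i => inl (inl i) | inr k => inr k end.

(* [A] and [B] as involutions of all the glued points, fixing those of the   *)
(* row on which they do not act.                                             *)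
Definition low_step s t u (A : diagram s t) (x : glued s t u) : glued s t u :=
  match x with inl p => low_pt u (A p) | inr k => inr k end.
Definition high_step s t u (B : diagram t u) (x : glued s t u) : glued s t u :=
  match x with
  | inl (inl i) => inl (inl i)
  | inl (inr j) => high_pt s (B (inl j))
  | inr k => high_pt s (B (inr k))
  end.

Definition glue s t u (B : diagram t u) (A : diagram s t) : rel (glued s t u) :=
  link (low_step A) (high_step B).

(* The partner of an outer point is the other outer point of its component.  *)
Definition stack_fun s t u (B : diagram t u) (A : diagram s t) :
    {ffun points s u -> points s u} :=
  [ffun x => odflt x
    [pick y | (y != x) && connect (glue B A) (outer_pt t x) (outer_pt t y)]].

(* Closed loops: components of the glued graph without outer point. *)
Definition loops s t u (B : diagram t u) (A : diagram s t) : nat :=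
  n_comp (glue B A)
    [pred x | [forall y : points s u, ~~ connect (glue B A) x (outer_pt t y)]].

Section Stack.
Variables (s t u : seq M) (B : diagram t u) (A : diagram s t).

Lemma low_stepK : involutive (@low_step s t u A).
Proof. by case=> [p|k] //=; rewrite /low_pt /=; have [-> _ _ _] := diagramP A p. Qed.

Lemma high_pt_step (p : points t u) :
  high_step B (high_pt s p) = high_pt s (B p).
Proof. by case: p. Qed.

Lemma high_stepK : involutive (@high_step s t u B).
Proof.
case=> [[i|j]|k] //=; rewrite high_pt_step.
  by have [-> _ _ _] := diagramP B (inl j).
by have [-> _ _ _] := diagramP B (inr k).
Qed.

Lemma high_pt_inj : injective (@high_pt s t u).
Proof. by case=> [j|k] [j'|k'] //= [->]. Qed.

Lemma outer_pt_inj : injective (@outer_pt s t u).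
Proof. by case=> [j|k] [j'|k'] //= [->]. Qed.

Lemma steps_no_fix (x : glued s t u) : low_step A x = x -> high_step B x <> x.
Proof.
case: x => [p|k] /=.
  by case=> H; have [_ /(_ H)] := diagramP A p.
by move=> _ /(@high_pt_inj _ (inr k)) H; have [_ /(_ H)] := diagramP B (inr k).
Qed.

Lemma outerE (x : glued s t u) :
  (low_step A x == x) || (high_step B x == x) <-> exists p, x = outer_pt t p.
Proof.
split; last by case=> [[i|k] ->] /=; rewrite eqxx ?orbT.
case: x => [[i|j]|k] H; [by exists (inl i) | exfalso | by exists (inr k)].
case/orP: H => /eqP /=.
  by case=> H; have [_ /(_ H)] := diagramP A (inr j).
by move=> /(@high_pt_inj _ (inl j)) H; have [_ /(_ H)] := diagramP B (inl j).
Qed.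

Lemma glue_sym : connect_sym (glue B A).
Proof. exact: link_sym low_stepK high_stepK. Qed.

Lemma stack_funP (x : points s u) :
  [/\ stack_fun B A x <> x,
      connect (glue B A) (outer_pt t x) (outer_pt t (stack_fun B A x))
    & forall z, z <> x -> connect (glue B A) (outer_pt t x) (outer_pt t z) ->
                z = stack_fun B A x].
Proof.
have [|y [yx yf cxy yu]] := link_end_unique (x := outer_pt t x)
  low_stepK high_stepK steps_no_fix.
  by apply/outerE; exists x.
have yu' z : z <> x -> connect (glue B A) (outer_pt t x) (outer_pt t z) ->
    outer_pt t z = y.
  move=> zx; apply: yu; first by apply/eqP=> /outer_pt_inj.
  by apply/outerE; exists z.
have [w yw] := (outerE y).1 yf; subst y.
rewrite ffunE; case: pickP => [y /andP[/eqP yx' cy] | /(_ w)] /=.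
  split=> // z zx cz; apply: outer_pt_inj.
  by rewrite (yu' z) // (yu' y).
by rewrite cxy andbT (contraNneq _ yx) // => ->.
Qed.

Definition gcolour (x : glued s t u) : M :=
  match x with inl p => colour p | inr k => nth v u k end.

Lemma gcolour_high (p : points t u) : gcolour (high_pt s p) = colour p.
Proof. by case: p. Qed.

Lemma gcolour_outer (p : points s u) : gcolour (outer_pt t p) = colour p.
Proof. by case: p. Qed.

Lemma gcolour_low_step x : gcolour (low_step A x) = gcolour x.
Proof. by case: x => //= p; have [_ _ -> _] := diagramP A p. Qed.

Lemma gcolour_high_step x : gcolour (high_step B x) = gcolour x.
Proof.
case: x => [[i|j]|k] //=; rewrite gcolour_high.
  by have [_ _ -> _] := diagramP B (inl j).
by have [_ _ -> _] := diagramP B (inr k).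
Qed.

Lemma gcolour_connect x y : connect (glue B A) x y -> gcolour y = gcolour x.
Proof.
case/connectP=> p; elim: p x => [|w p IH] x /=; first by move=> _ ->.
case/andP=> /orP[] /eqP-> Hp Hy; rewrite (IH _ Hp Hy).
  exact: gcolour_low_step.
exact: gcolour_high_step.
Qed.

Lemma across_low (p : points s t) : colour p != v ->
  is_bottom (A p) = ~~ is_bottom p.
Proof.
move=> nv; have [_ _ _ h] := diagramP A p.
by move: nv h; case: (is_bottom _); case: (is_bottom _) => // nv /(_ erefl) h;
  rewrite h eqxx in nv.
Qed.

Lemma across_high (p : points t u) : colour p != v ->
  is_bottom (B p) = ~~ is_bottom p.
Proof.
move=> nv; have [_ _ _ h] := diagramP B p.
by move: nv h; case: (is_bottom _); case: (is_bottom _) => // nv /(_ erefl) h;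
  rewrite h eqxx in nv.
Qed.

Lemma across_stack (x : points s u) : colour x != v ->
  is_bottom (stack_fun B A x) = ~~ is_bottom x.
Proof.
move=> nv; have [_ _ uniq_x] := stack_funP x.
suff [z zb cz] : exists2 z : points s u, is_bottom z = ~~ is_bottom x
    & connect (glue B A) (outer_pt t x) (outer_pt t z).
  rewrite -(uniq_x z) // => zx; move: zb; rewrite zx.
  by case: (is_bottom x).
case: x nv {uniq_x} => [i|k] nv.
  have cA := across_low (p := inl i) nv.
  case EA : (A (inl i)) cA => [//|j] _.
  have [_ _ cj _] := diagramP A (inl i); rewrite EA /= in cj.
  have cB : is_bottom (B (inl j)) = false by rewrite across_high //= cj.
  case EB : (B (inl j)) cB => [//|k] _; exists (inr k) => //.
  apply: (@connect_trans _ _ (inl (inr j))); apply: connect1; apply/orP.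
    by left; rewrite /= /low_pt EA.
  by right; rewrite /= EB.
have cB := across_high (p := inr k) nv.
case EB : (B (inr k)) cB => [j|//] _.
have [_ _ cj _] := diagramP B (inr k); rewrite EB /= in cj.
have cA : is_bottom (A (inr j)) = true by rewrite across_low //= cj.
case EA : (A (inr j)) cA => [i|//] _; exists (inl i) => //.
apply: (@connect_trans _ _ (inl (inr j))); apply: connect1; apply/orP.
  by right; rewrite /= EB.
by left; rewrite /= /low_pt EA.
Qed.

Lemma stack_subproof : is_brauer (stack_fun B A).
Proof.
apply/brauerP => p; have [sp cp up] := stack_funP p.
have [sq cq uq] := stack_funP (stack_fun B A p).
split=> //.
- by apply/esym/uq; [move=> /esym | rewrite glue_sym].
- by have := gcolour_connect cp; rewrite !gcolour_outer.
- move=> sb; apply/eqP/negPn/negP => /across_stack; rewrite sb.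
  by case: (is_bottom p).
Qed.

Definition stack : diagram s u := Diagram stack_subproof.
End Stack.

Definition through_fun s t (f : 'I_(size s) -> 'I_(size t))
    (g : 'I_(size t) -> 'I_(size s)) : {ffun points s t -> points s t} :=
  [ffun p : points s t => match p with inl i => inr (f i) | inr j => inl (g j) end].

Lemma through_brauer s t (f : 'I_(size s) -> 'I_(size t)) g :
  cancel f g -> cancel g f -> (forall i, nth v t (f i) = nth v s i) ->
  is_brauer (through_fun f g).
Proof.
move=> fK gK fc; apply/brauerP; case=> [i|j]; rewrite !ffunE //=.
  by rewrite fK.
by split=> //; rewrite ?gK // -{2}(gK j) fc.
Qed.

Definition id_diagram s : diagram s s :=
  Diagram (@through_brauer s s id id (frefl _) (frefl _) (frefl _)).

Definition lpos s t (i : 'I_(size s)) : 'I_(size (s ++ t)) :=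
  cast_ord (esym (size_cat s t)) (lshift (size t) i).
Definition rpos s t (j : 'I_(size t)) : 'I_(size (s ++ t)) :=
  cast_ord (esym (size_cat s t)) (rshift (size s) j).
Definition split_pos s t (k : 'I_(size (s ++ t))) : 'I_(size s) + 'I_(size t) :=
  split (cast_ord (size_cat s t) k).

Lemma split_lpos s t i : split_pos (@lpos s t i) = inl i.
Proof. by rewrite /split_pos cast_ordKV (unsplitK (inl i)). Qed.

Lemma split_rpos s t j : split_pos (@rpos s t j) = inr j.
Proof. by rewrite /split_pos cast_ordKV (unsplitK (inr j)). Qed.

Variant pos_spec s t (k : 'I_(size (s ++ t))) :
    'I_(size (s ++ t)) -> 'I_(size s) + 'I_(size t) -> Prop :=
  | PosL i of k = lpos t i : pos_spec k (lpos t i) (inl i)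
  | PosR j of k = rpos s j : pos_spec k (rpos s j) (inr j).

Lemma posP s t (k : 'I_(size (s ++ t))) : pos_spec k k (split_pos k).
Proof.
have kE : k = match split_pos k with inl i => lpos t i | inr j => rpos s j end.
  apply: (can_inj (cast_ordK (size_cat s t))).
  rewrite -[LHS]splitK /split_pos.
  by case: (split _) => i /=; rewrite cast_ordKV.
by case E : (split_pos k) kE => [i|j] kE; rewrite {2}kE; constructor.
Qed.

Lemma nth_lpos s t i : nth v (s ++ t) (@lpos s t i) = nth v s i.
Proof. by rewrite nth_cat /= ltn_ord. Qed.

Lemma nth_rpos s t j : nth v (s ++ t) (@rpos s t j) = nth v t j.
Proof. by rewrite nth_cat /= ltnNge leq_addr /= addKn. Qed.

Definition swap_pos s t (k : 'I_(size (s ++ t))) : 'I_(size (t ++ s)) :=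
  match split_pos k with inl i => rpos t i | inr j => lpos s j end.

Lemma swap_posK s t : cancel (@swap_pos s t) (@swap_pos t s).
Proof.
by move=> k; rewrite /swap_pos; case: (posP k) => i _;
  rewrite ?split_lpos ?split_rpos.
Qed.

Lemma nth_swap_pos s t k : nth v (t ++ s) (@swap_pos s t k) = nth v (s ++ t) k.
Proof.
by rewrite /swap_pos; case: (posP k) => i _; rewrite !(nth_lpos, nth_rpos).
Qed.

(* X(s, t) : two crossing blocks of parallel strands. *)
Definition cross_diagram s t : diagram (s ++ t) (t ++ s) :=
  Diagram (through_brauer (@swap_posK s t) (@swap_posK t s) (@nth_swap_pos s t)).

Definition arc_fun s t : {ffun points s t -> points s t} :=
  [ffun p : points s t =>
     match p with inl i => inl (rev_ord i) | inr j => inr (rev_ord j) end].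

Lemma cap_subproof : is_brauer (arc_fun [:: v; v] [::]).
Proof.
apply/brauerP; case=> [i|[]//]; rewrite !ffunE rev_ordK /=.
by case: i => -[|[|//]] ?; split.
Qed.

Lemma cup_subproof : is_brauer (arc_fun [::] [:: v; v]).
Proof.
apply/brauerP; case=> [[]//|j]; rewrite !ffunE rev_ordK /=.
by case: j => -[|[|//]] ?; split.
Qed.

Definition cap_diagram : diagram [:: v; v] [::] := Diagram cap_subproof.
Definition cup_diagram : diagram [::] [:: v; v] := Diagram cup_subproof.

Section Juxtapose.
Variables (s s' t t' : seq M) (A : diagram s t) (B : diagram s' t').

Definition left_pt (p : points s t) : points (s ++ s') (t ++ t') :=
  match p with inl i => inl (lpos s' i) | inr j => inr (lpos t' j) end.
Definition right_pt (p : points s' t') : points (s ++ s') (t ++ t') :=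
  match p with inl i => inl (rpos s i) | inr j => inr (rpos t j) end.
Definition split_pt (p : points (s ++ s') (t ++ t')) :
    points s t + points s' t' :=
  match p with
  | inl k => match split_pos k with inl i => inl (inl i) | inr i => inr (inl i) end
  | inr k => match split_pos k with inl j => inl (inr j) | inr j => inr (inr j) end
  end.

Definition juxtapose_fun :
    {ffun points (s ++ s') (t ++ t') -> points (s ++ s') (t ++ t')} :=
  [ffun p => match split_pt p with
             | inl q => left_pt (A q)
             | inr q => right_pt (B q)
             end].

Lemma split_left_pt p : split_pt (left_pt p) = inl p.
Proof. by case: p => i; rewrite /= split_lpos. Qed.

Lemma split_right_pt p : split_pt (right_pt p) = inr p.
Proof. by case: p => i; rewrite /= split_rpos. Qed.

Lemma left_or_right p : (exists q, p = left_pt q) \/ (exists q, p = right_pt q).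
Proof.
case: p => k; case: (posP k) => i _; [left; exists (inl i) | right; exists (inl i)
  | left; exists (inr i) | right; exists (inr i)] => //.
Qed.

Lemma colour_left_pt p : colour (left_pt p) = colour p.
Proof. by case: p => i; rewrite /= nth_lpos. Qed.

Lemma colour_right_pt p : colour (right_pt p) = colour p.
Proof. by case: p => i; rewrite /= nth_rpos. Qed.

Lemma juxtapose_left p : juxtapose_fun (left_pt p) = left_pt (A p).
Proof. by rewrite ffunE split_left_pt. Qed.

Lemma juxtapose_right p : juxtapose_fun (right_pt p) = right_pt (B p).
Proof. by rewrite ffunE split_right_pt. Qed.

Lemma juxtapose_subproof : is_brauer juxtapose_fun.
Proof.
have lb q : is_bottom (left_pt q) = is_bottom q by case: q.
have rb q : is_bottom (right_pt q) = is_bottom q by case: q.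
apply/brauerP => p; case: (left_or_right p) => -[q ->].
  have [h1 h2 h3 h4] := diagramP A q.
  rewrite !juxtapose_left h1 !colour_left_pt !lb; split=> //.
  by move/(congr1 split_pt); rewrite !split_left_pt => -[].
have [h1 h2 h3 h4] := diagramP B q.
rewrite !juxtapose_right h1 !colour_right_pt !rb; split=> //.
by move/(congr1 split_pt); rewrite !split_right_pt => -[].
Qed.

Definition juxtapose : diagram (s ++ s') (t ++ t') := Diagram juxtapose_subproof.
End Juxtapose.
End Diagrams.

Arguments id_diagram {M} v s.
Arguments cross_diagram {M} v s t.

(* Formal expressions for morphisms; the Hom-spaces are their quotients by   *)
(* the relations [hb_eq] and [hat_eq] below.  The objects form the monoid    *)
(* [seq M].                                                                  *)
Inductive mor (K : fieldType) (M : finType) (v : M) : seq M -> seq M -> Type :=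
  | Diag s t (D : diagram v s t) : mor K v s t
  | Omega : mor K v [::] [:: v; v; v]
  | HH (a b : M) : mor K v [:: a; b] [:: a; b]
  | Comp s t u (g : mor K v t u) (f : mor K v s t) : mor K v s u
  | Tens s t s' t' (f : mor K v s t) (g : mor K v s' t') :
      mor K v (s ++ s') (t ++ t')
  | Zero s t : mor K v s t
  | Add s t (f g : mor K v s t) : mor K v s t
  | Scale s t (k : K) (f : mor K v s t) : mor K v s t.

Arguments Diag K {M v s t} D.
Arguments Omega {K M v}.
Arguments HH {K M v} a b.
Arguments Zero {K M v s t}.

Declare Scope mor_scope.
Delimit Scope mor_scope with mor.
Bind Scope mor_scope with mor.

Reserved Notation "g \bo f" (at level 48, left associativity).
Reserved Notation "f \ox g" (at level 40, left associativity).
Notation "g \bo f" := (Comp g f) : mor_scope.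
Notation "f \ox g" := (Tens f g) : mor_scope.
Notation "f + g" := (Add f g) : mor_scope.
Notation "k *: f" := (Scale k f) : mor_scope.
Notation "- f" := (Scale (-1)%R f) : mor_scope.
Notation "f - g" := (Add f (Scale (-1)%R g)) : mor_scope.
Notation "0" := Zero : mor_scope.

Section Category.
Variables (K : fieldType) (M : finType) (v : M) (delta : K).
Implicit Types s t u w : seq M.
Local Notation hom := (mor K v).
Local Open Scope mor_scope.

(* Transport along equalities of objects, to state strictness. *)
Definition castm s s' t t' (es : s = s') (et : t = t') (f : hom s t) :
    hom s' t' :=
  ecast y (hom s' y) et (ecast x (hom x t) es f).

Definition idm s : hom s s := Diag K (id_diagram v s).
Definition crossm s t : hom (s ++ t) (t ++ s) := Diag K (cross_diagram v s t).

(* The least K-linear strict monoidal congruence for which [Diag] is a       *)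
(* strict monoidal functor from the Brauer category and which contains R.    *)
Inductive mon_eq (R : forall s t, hom s t -> hom s t -> Prop) :
    forall s t, hom s t -> hom s t -> Prop :=
  | me_rel s t (f g : hom s t) : R s t f g -> mon_eq R f g
  | me_refl s t (f : hom s t) : mon_eq R f f
  | me_sym s t (f g : hom s t) : mon_eq R f g -> mon_eq R g f
  | me_trans s t (f g h : hom s t) :
      mon_eq R f g -> mon_eq R g h -> mon_eq R f h
  | me_Comp s t u (g g' : hom t u) (f f' : hom s t) :
      mon_eq R g g' -> mon_eq R f f' -> mon_eq R (g \bo f) (g' \bo f')
  | me_Tens s t s' t' (f f' : hom s t) (g g' : hom s' t') :
      mon_eq R f f' -> mon_eq R g g' -> mon_eq R (f \ox g) (f' \ox g')
  | me_Add s t (f f' g g' : hom s t) :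
      mon_eq R f f' -> mon_eq R g g' -> mon_eq R (f + g) (f' + g')
  | me_Scale s t k (f f' : hom s t) :
      mon_eq R f f' -> mon_eq R (k *: f) (k *: f')
  | me_addA s t (f g h : hom s t) : mon_eq R (f + (g + h)) (f + g + h)
  | me_addC s t (f g : hom s t) : mon_eq R (f + g) (g + f)
  | me_add0 s t (f : hom s t) : mon_eq R (0 + f) f
  | me_subff s t (f : hom s t) : mon_eq R (f - f) 0
  | me_scaleA s t (k l : K) (f : hom s t) :
      mon_eq R (k *: (l *: f)) ((k * l)%R *: f)
  | me_scale1 s t (f : hom s t) : mon_eq R (1%R *: f) f
  | me_scaleDr s t (k : K) (f g : hom s t) :
      mon_eq R (k *: (f + g)) (k *: f + k *: g)
  | me_scaleDl s t (k l : K) (f : hom s t) :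
      mon_eq R ((k + l)%R *: f) (k *: f + l *: f)
  | me_compA s t u w (h : hom u w) (g : hom t u) (f : hom s t) :
      mon_eq R (h \bo (g \bo f)) (h \bo g \bo f)
  | me_id_comp s t (f : hom s t) : mon_eq R (idm t \bo f) f
  | me_comp_id s t (f : hom s t) : mon_eq R (f \bo idm s) f
  | me_compDl s t u (g g' : hom t u) (f : hom s t) :
      mon_eq R ((g + g') \bo f) (g \bo f + g' \bo f)
  | me_compDr s t u (g : hom t u) (f f' : hom s t) :
      mon_eq R (g \bo (f + f')) (g \bo f + g \bo f')
  | me_compZl s t u (k : K) (g : hom t u) (f : hom s t) :
      mon_eq R ((k *: g) \bo f) (k *: (g \bo f))
  | me_compZr s t u (k : K) (g : hom t u) (f : hom s t) :
      mon_eq R (g \bo (k *: f)) (k *: (g \bo f))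
  | me_interchange s t u s' t' u'
      (g : hom t u) (f : hom s t) (g' : hom t' u') (f' : hom s' t') :
      mon_eq R ((g \bo f) \ox (g' \bo f')) ((g \ox g') \bo (f \ox f'))
  | me_tens_id s t : mon_eq R (idm s \ox idm t) (idm (s ++ t))
  | me_tensA s t s' t' s'' t'' (f : hom s t) (g : hom s' t') (h : hom s'' t'') :
      mon_eq R (castm (catA s s' s'') (catA t t' t'') (f \ox (g \ox h)))
               (f \ox g \ox h)
  | me_tens0l s t (f : hom s t) : mon_eq R (idm [::] \ox f) f
  | me_tens0r s t (f : hom s t) :
      mon_eq R (castm (cats0 s) (cats0 t) (f \ox idm [::])) f
  | me_tensDl s t s' t' (f f' : hom s t) (g : hom s' t') :
      mon_eq R ((f + f') \ox g) (f \ox g + f' \ox g)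
  | me_tensDr s t s' t' (f : hom s t) (g g' : hom s' t') :
      mon_eq R (f \ox (g + g')) (f \ox g + f \ox g')
  | me_tensZl s t s' t' (k : K) (f : hom s t) (g : hom s' t') :
      mon_eq R ((k *: f) \ox g) (k *: (f \ox g))
  | me_tensZr s t s' t' (k : K) (f : hom s t) (g : hom s' t') :
      mon_eq R (f \ox (k *: g)) (k *: (f \ox g))
  | me_stack s t u (B : diagram v t u) (A : diagram v s t) :
      mon_eq R (Diag K B \bo Diag K A)
               ((delta ^+ loops B A)%R *: Diag K (stack B A))
  | me_juxtapose s t s' t' (A : diagram v s t) (B : diagram v s' t') :
      mon_eq R (Diag K A \ox Diag K B) (Diag K (juxtapose A B)).

Local Notation II := (idm [:: v]).
Local Notation Id a := (idm [:: a]).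
Local Notation XX a b := (crossm [:: a] [:: b]).
Local Notation X := (XX v v).
Local Notation cap := (Diag K (cap_diagram v)).
Local Notation cup := (Diag K (cup_diagram v)).
Local Notation E := (cup \bo cap).

Inductive coupon : forall s t, hom s t -> Prop :=
  | coupon_Omega : coupon Omega
  | coupon_HH a b : coupon (HH a b).

Definition H12 (a b c : M) : hom [:: a; b; c] [:: a; b; c] := HH a b \ox Id c.
Definition H23 (a b c : M) : hom [:: a; b; c] [:: a; b; c] := Id a \ox HH b c.
Definition H13 (a b c : M) : hom [:: a; b; c] [:: a; b; c] :=
  (Id a \ox XX c b) \bo (HH a c \ox Id b) \bo (Id a \ox XX b c).

(* Rotation by 180 degrees of an endomorphism of v^2: its outputs are bent   *)
(* down by nested caps on the right, its inputs up by nested cups on the     *)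
(* left.                                                                     *)
Definition rotate (f : hom [:: v; v] [:: v; v]) : hom [:: v; v] [:: v; v] :=
  let cap2 : hom [:: v; v; v; v] [::] := cap \bo (II \ox cap \ox II) in
  let cup2 : hom [::] [:: v; v; v; v] := (II \ox cup \ox II) \bo cup in
  (II \ox II \ox cap2) \bo (II \ox II \ox f \ox II \ox II)
    \bo (cup2 \ox II \ox II).

Definition commutator s (f g : hom s s) : hom s s := f \bo g - g \bo f.

Inductive hb_rel : forall s t, hom s t -> hom s t -> Prop :=
  | rel_slide_left s t (g : hom s t) (c : seq M) : coupon g ->
      hb_rel (crossm c t \bo (idm c \ox g)) ((g \ox idm c) \bo crossm c s)
  | rel_slide_right s t (g : hom s t) (c : seq M) : coupon g ->
      hb_rel (crossm t c \bo (g \ox idm c)) ((idm c \ox g) \bo crossm s c)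
  | rel_duality : hb_rel (HH v v) (rotate (HH v v))
  | rel_symmetry (a b : M) :
      hb_rel (XX b a \bo HH b a) (HH a b \bo XX b a)
  | rel_skew_left (a : M) :
      hb_rel ((II \ox cap \ox Id a) \bo (X \ox HH v a) \bo (II \ox cup \ox Id a))
             (- HH v a)
  | rel_skew_right (a : M) :
      hb_rel ((Id a \ox cap \ox II) \bo (HH a v \ox X) \bo (Id a \ox cup \ox II))
             (- HH a v)
  | rel_braid_left (a b c : M) :
      hb_rel (commutator (H12 a b c) (H13 a b c + H23 a b c)) 0
  | rel_braid_right (a b c : M) :
      hb_rel (commutator (H12 a b c + H13 a b c) (H23 a b c)) 0
  | rel_alt_left : hb_rel ((X \ox II) \bo Omega) (- Omega)
  | rel_alt_right : hb_rel ((II \ox X) \bo Omega) (- Omega).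

(* Equality of morphisms in HB_omega3(delta). *)
Definition hb_eq s t (f g : hom s t) : Prop := mon_eq hb_rel f g.

Definition Upsilon : hom [:: v] [:: v; v] :=
  (II \ox II \ox cap) \bo (Omega \ox II).
Definition hatUpsilon : hom [:: v; v] [:: v] :=
  (II \ox cap) \bo (Upsilon \ox II).

(* The tensor ideal of HB_omega3(delta) generated by G. *)
Inductive tensor_ideal (G : forall s t, hom s t -> Prop) :
    forall s t, hom s t -> Prop :=
  | ideal_gen s t (f : hom s t) : G s t f -> tensor_ideal G f
  | ideal_eq s t (f g : hom s t) :
      hb_eq f g -> tensor_ideal G f -> tensor_ideal G g
  | ideal_zero s t : tensor_ideal G (0 : hom s t)
  | ideal_add s t (f g : hom s t) :
      tensor_ideal G f -> tensor_ideal G g -> tensor_ideal G (f + g)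
  | ideal_scale s t (k : K) (f : hom s t) :
      tensor_ideal G f -> tensor_ideal G (k *: f)
  | ideal_comp_left s t u (g : hom t u) (f : hom s t) :
      tensor_ideal G f -> tensor_ideal G (g \bo f)
  | ideal_comp_right s t u (g : hom t u) (f : hom s t) :
      tensor_ideal G g -> tensor_ideal G (g \bo f)
  | ideal_tens_left s t s' t' (g : hom s t) (f : hom s' t') :
      tensor_ideal G f -> tensor_ideal G (g \ox f)
  | ideal_tens_right s t s' t' (f : hom s t) (g : hom s' t') :
      tensor_ideal G f -> tensor_ideal G (f \ox g).

Inductive hat_gen : forall s t, hom s t -> Prop :=
  | gen_bubble : hat_gen (hatUpsilon \bo Upsilon - 6%:R%R *: II)
  | gen_H : hat_gen (HH v v - X + 2%:R%R *: E - (II \ox II)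
                       + Upsilon \bo hatUpsilon).

Definition hat_eq s t (f g : hom s t) : Prop := tensor_ideal hat_gen (f - g).
End Category.

Arguments idm K {M} v s.

(* Main.v *)
Require Import Defs.
From mathcomp Require Import all_boot all_algebra.
From mathcomp Require Import zify ring.
From Stdlib Require Import Setoid Morphisms.

(** The relation for the coupon [H = HH v v] says
      [H = X - 2 E + I I - U U'],   where [U = Upsilon] and [U' = hatUpsilon],
    and the skew relation says that [H] changes sign when its first strand is
    turned upside down ([flip_first]).  The flip fixes [I I] and exchanges [X] and [E],
    so adding the expansion of [H] to its flip gives
      [U U' + flip (U U') = 2 I I - X - E],
    the identity for iterated vector products, with [v] in the role of a space
    of dimension [delta].  Now feed the cup into this identity.  The right-hand
    side becomes [(1 - delta) cup].  On the left, [flip (U U') cup] consists of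
    two trivalent vertices joined by two edges; it is [- 6 cup] by the relation
    [U' U = 6 I] and the alternation of the coupon ([flip_Upsilon_hatUpsilon]).
    With [u = U' cup] this reads
      [U u = (7 - delta) cup]   ([Upsilon_hatUpsilon_cup]).

    The tensor [u : [::] -> v] is the contraction of two legs of an alternating
    tensor, so [2 u = 0], which does not make it vanish in characteristic 2.
    But applying [U'] to the identity gives [(7 - delta) u = 6 u = 0], hence
    [(7 - delta)^2 cup = (7 - delta) U u = 0] in every characteristic.  If
    [delta] is not 7, the cup is zero, and with it [I], by the zigzag identity.

    To evaluate the pictures, sliding and bending move all coupons to the
    bottom left, so that a picture becomes a word in Brauer diagrams applied to
    a tensor power of the coupon.  Two such words are compared by computing
    their matchings as lists of numbers: [tabulates_stack] shows that a walk in
    the glued graph computes the composite, and the tactic [brauer] proves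
    equality of words in which no closed loop arises.  The only loop needed is
    [cap_cup]. *)

Import GRing.Theory.
Local Open Scope ring_scope.
Set Implicit Arguments.
Unset Strict Implicit.
Unset Printing Implicit Defensive.

(** * Brauer diagrams as tables of numbers *)

Local Open Scope nat_scope.

Section Tables.
Variables (M : finType) (v : M).
Implicit Types s t u : seq M.

(** Numbering the bottom points first makes the numbers of the points of [A]
    agree with those of the glued points in which [A] is stacked below [B]. *)
Definition code s t (p : points s t) : nat :=
  match p with inl i => i | inr j => size s + j end.

Lemma code_inj s t : injective (@code s t).
Proof.
case=> [i|j] [i'|j'] /= E.
- by congr inl; apply: val_inj.
- by have := ltn_ord i; lia.
- by have := ltn_ord i'; lia.
- by congr inr; apply: val_inj => /=; lia.
Qed.

Lemma code_lt s t (p : points s t) : code p < size s + size t.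
Proof. by case: p => i /=; have := ltn_ord i; lia. Qed.

Definition tabulates s t (ta : seq nat) (D : diagram v s t) : Prop :=
  forall p, code (D p) = nth 0 ta (code p).

Lemma tabulates_inj s t (ta : seq nat) (D D' : diagram v s t) :
  tabulates ta D -> tabulates ta D' -> D = D'.
Proof.
move=> H H'; apply/val_inj/ffunP => p.
by apply: code_inj; rewrite [LHS]H [RHS]H'.
Qed.

Definition table n (f : nat -> nat) := [seq f c | c <- iota 0 n].

Lemma nth_table n f c : c < n -> nth 0 (table n f) c = f c.
Proof. by move=> lt_c; rewrite (nth_map 0) ?size_iota // nth_iota. Qed.

Definition cross_table a b := table (a + b + (b + a)) (fun c =>
  if c < a then a + b + (b + c) else if c < a + b then a + b + (c - a)
  else if c < a + b + b then c - b else c - (a + b + b)).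

(** The identity is the crossing of a block with the empty block. *)
Definition id_table a := cross_table 0 a.

Lemma tabulates_id s : tabulates (id_table (size s)) (id_diagram v s).
Proof.
move=> p; rewrite nth_table; last by have := code_lt p; lia.
by case: p => i; rewrite ffunE /=; have := ltn_ord i; do !case: ifP; lia.
Qed.

Lemma tabulates_cross s t :
  tabulates (cross_table (size s) (size t)) (cross_diagram v s t).
Proof.
move=> p; rewrite nth_table; last by have := code_lt p; rewrite !size_cat; lia.
by case: p => i; rewrite ffunE /= /swap_pos; case: (posP i) => j _ /=;
  rewrite ?size_cat; have := ltn_ord j; do !case: ifP; lia.
Qed.

Lemma tabulates_cap : tabulates [:: 1; 0] (cap_diagram v).
Proof. by case=> [[[|[|//]] ?]|[]//]; rewrite ffunE. Qed.

Lemma tabulates_cup : tabulates [:: 1; 0] (cup_diagram v).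
Proof. by case=> [[]//|[[|[|//]] ?]]; rewrite ffunE. Qed.

Definition juxtapose_table m n m' n' (ta tb : seq nat) :=
  let left c := if c < m then c else c + m' in
  let right c := if c < m' then m + c else m + n + c in
  table (m + m' + (n + n')) (fun c =>
    if c < m then left (nth 0 ta c)
    else if c < m + m' then right (nth 0 tb (c - m))
    else if c < m + m' + n then left (nth 0 ta (c - m'))
    else right (nth 0 tb (c - (m + n)))).

Lemma tabulates_juxtapose s t s' t' ta tb
    (A : diagram v s t) (B : diagram v s' t') :
  tabulates ta A -> tabulates tb B ->
  tabulates (juxtapose_table (size s) (size t) (size s') (size t') ta tb)
            (juxtapose A B).
Proof.
move=> HA HB p.
rewrite nth_table; last by have := code_lt p; rewrite !size_cat; lia.
have left_code (q : points s t) : code (left_pt s' t' q) =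
    if code q < size s then code q else code q + size s'.
  by case: q => i /=; rewrite ?size_cat; have := ltn_ord i; case: ifP; lia.
have right_code (q : points s' t') : code (right_pt s t q) =
    if code q < size s' then size s + code q else size s + size t + code q.
  by case: q => i /=; rewrite ?size_cat; have := ltn_ord i; case: ifP; lia.
case: (left_or_right p) => -[q ->].
  rewrite [juxtapose A B _]juxtapose_left !left_code HA.
  case: q => i /=; have lt_i := ltn_ord i; first by rewrite !lt_i.
  have -> : (size s + i < size s) = false by lia.
  have -> : (size s + i + size s' < size s) = false by lia.
  have -> : (size s + i + size s' < size s + size s') = false by lia.
  rewrite addnK (_ : (size s + i + size s' < _) = true) //.
  by rewrite addnAC ltn_add2l.
rewrite [juxtapose A B _]juxtapose_right !right_code HB.
case: q => i /=; have lt_i := ltn_ord i.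
  rewrite lt_i ltn_add2l lt_i addKn.
  by have -> : (size s + i < size s) = false by lia.
have -> : (size s' + i < size s') = false by lia.
have -> : size s + size t + (size s' + i) - (size s + size t) = size s' + i.
  by lia.
do 3![rewrite (_ : (size s + size t + (size s' + i) < _) = false); last by lia].
by [].
Qed.

Section StackTable.
Variables m n p : nat.
Variables tb ta : seq nat.

Definition low_move c := if c < m + n then nth 0 ta c else c.
Definition high_move c := if c < m then c else m + nth 0 tb (c - m).
(** The moves are involutions, so from any point the iterates of their
    composite together with one more move cover its component; [m + n + p]
    iterations suffice because that is the number of glued points. *)
Definition walk c :=
  flatten [seq [:: d; low_move d]
          | d <- traject (high_move \o low_move) c (m + n + p)].
Definition exits c := [seq d <- walk c | (d < m) || (m + n <= d) & d != c].
Definition outer_code c := if c < m then c else c + n.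
Definition stack_table := table (m + p) (fun c =>
  let d := head 0 (exits (outer_code c)) in if d < m then d else d - n).
(** Asking that every point, outer or not, can leave to another outer point
    does two things: it excludes closed loops, and it guarantees that the head
    of [exits] is not the default value. *)
Definition no_loop := all (fun c => exits c != [::]) (iota 0 (m + n + p)).
End StackTable.

Definition gcode s t u (x : glued s t u) : nat :=
  match x with inl q => code q | inr k => size s + size t + k end.

Lemma gcode_lt s t u (x : glued s t u) : gcode x < size s + size t + size u.
Proof.
by case: x => [q|k] /=; [have := code_lt q | have := ltn_ord k]; lia.
Qed.

Section StackCorrect.
Variables (s t u : seq M) (B : diagram v t u) (A : diagram v s t).
Variables tb ta : seq nat.
Hypotheses (HB : tabulates tb B) (HA : tabulates ta A).
Hypothesis noloop : no_loop (size s) (size t) (size u) tb ta.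
Let m := size s.
Let n := size t.
Let p := size u.

Lemma gcode_low (x : glued s t u) :
  gcode (low_step A x) = low_move m n ta (gcode x).
Proof.
case: x => [q|k] /=; rewrite /low_move; first by rewrite code_lt HA.
by rewrite ltnNge leq_addr.
Qed.

Lemma gcode_high_pt (q : points t u) : gcode (high_pt s q) = m + code q.
Proof. by case: q => i //=; rewrite -addnA. Qed.

Lemma gcode_high (x : glued s t u) :
  gcode (high_step B x) = high_move m tb (gcode x).
Proof.
case: x => [[i|j]|k] /=; rewrite /high_move ?ltn_ord //.
  by rewrite gcode_high_pt HB ltnNge leq_addr /= addKn.
by rewrite gcode_high_pt HB -addnA ltnNge leq_addr /= addKn.
Qed.

Lemma walkP (x : glued s t u) d : d \in walk m n p tb ta (gcode x) ->
  exists2 y, gcode y = d & connect (glue B A) x y.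
Proof.
case/flattenP => l /mapP[e /trajectP[k _ ->] ->] {l e}.
have [y yE cy] : exists2 y : glued s t u,
    gcode y = iter k (high_move m tb \o low_move m n ta) (gcode x)
    & connect (glue B A) x y.
  elim: k => [|k [y yE cy]]; first by exists x; rewrite ?connect0.
  exists (high_step B (low_step A y)); first by rewrite gcode_high gcode_low yE.
  apply: (connect_trans cy); apply: (@connect_trans _ _ (low_step A y));
    by apply: connect1; rewrite /glue /link eqxx ?orbT.
rewrite -yE !inE => /orP[] /eqP->; first by exists y.
exists (low_step A y); first exact: gcode_low.
by apply: (connect_trans cy); apply: connect1; rewrite /glue /link eqxx.
Qed.

Lemma exitsP (x : glued s t u) : exists y : points s u,
  [/\ outer_pt t y <> x, connect (glue B A) x (outer_pt t y)
    & gcode (outer_pt t y) = head 0 (exits m n p tb ta (gcode x))].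
Proof.
have := allP noloop (gcode x); rewrite mem_iota gcode_lt => /(_ isT).
case E : exits => [//|d ds] _ /=.
have : d \in exits m n p tb ta (gcode x) by rewrite E mem_head.
rewrite mem_filter => /andP[/andP[d_out dx] /walkP[y yE cy]].
have {}dx : y <> x by move=> yx; rewrite -yE yx eqxx in dx.
rewrite -yE in d_out *; case: y cy dx d_out {yE} => [[i|j]|k] cy dx /= d_out.
- by exists (inl i).
- by have := ltn_ord j; lia.
- by exists (inr k).
Qed.

Lemma gcode_outer (y : points s u) :
  gcode (outer_pt t y) = outer_code m n (code y).
Proof.
case: y => [i|k] /=; rewrite /outer_code ?ltn_ord //.
by rewrite ltnNge leq_addr /= -/m -/n; lia.
Qed.

(** The partner of an outer point in the stack is the only other outer point
    of its component, so whichever exit the walk meets first is the partner. *)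
Lemma tabulates_stack : tabulates (stack_table m n p tb ta) (stack B A).
Proof.
move=> x; have [y [yx cy yE]] := exitsP (outer_pt t x).
have [_ _ /(_ y) stackE] := stack_funP B A x.
have -> : stack B A x = y by rewrite -[LHS]stackE // => E; rewrite E in yx.
rewrite nth_table ?code_lt // -gcode_outer -yE gcode_outer /outer_code.
case: (ltnP (code y) m) => [->//|le_m].
by rewrite ltnNge (leq_trans le_m (leq_addr _ _)) /= addnK.
Qed.

Lemma loops0 : loops B A = 0.
Proof.
rewrite /loops /n_comp_mem; apply: eq_card0 => x.
apply/negP => /andP[_ /forallP no_outer].
by have [y [_ cy _]] := exitsP x; move: (no_outer y); rewrite cy.
Qed.
End StackCorrect.
End Tables.

Local Close Scope nat_scope.

(** * Calculation rules of a monoidal congruence *)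

#[local] Hint Resolve me_refl : core.

Section Congruence.
Variables (K : fieldType) (M : finType) (v : M) (delta : K).
Variable R : forall s t, mor K v s t -> mor K v s t -> Prop.

Global Instance mon_equiv s t : Equivalence (@mon_eq K M v delta R s t).
Proof.
split; first exact: me_refl.
  by move=> f g; apply: me_sym.
by move=> f g h; apply: me_trans.
Qed.

Global Instance mon_Comp s t u :
  Proper (@mon_eq _ _ v delta R t u ==> @mon_eq _ _ v delta R s t
          ==> @mon_eq _ _ v delta R s u) (@Comp K M v s t u).
Proof. by move=> g g' Hg f f' Hf; apply: me_Comp. Qed.

Global Instance mon_Tens s t s' t' :
  Proper (@mon_eq _ _ v delta R s t ==> @mon_eq _ _ v delta R s' t'
          ==> @mon_eq _ _ v delta R _ _) (@Tens K M v s t s' t').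
Proof. by move=> f f' Hf g g' Hg; apply: me_Tens. Qed.

Global Instance mon_Add s t :
  Proper (@mon_eq _ _ v delta R s t ==> @mon_eq _ _ v delta R s t
          ==> @mon_eq _ _ v delta R s t) (@Add K M v s t).
Proof. by move=> f f' Hf g g' Hg; apply: me_Add. Qed.

Global Instance mon_Scale s t k :
  Proper (@mon_eq _ _ v delta R s t ==> @mon_eq _ _ v delta R s t)
         (@Scale K M v s t k).
Proof. by move=> f f' Hf; apply: me_Scale. Qed.
End Congruence.

Section Linear.
Variables (K : fieldType) (M : finType) (v : M) (delta : K).
Variable R : forall s t, mor K v s t -> mor K v s t -> Prop.
Implicit Types s t u : seq M.
Local Notation hom := (mor K v).
Local Open Scope mor_scope.
Local Notation "f =m g" := (mon_eq delta R f g) (at level 70).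

Lemma me_addr0 s t (f : hom s t) : f + 0 =m f.
Proof. by rewrite me_addC; apply: me_add0. Qed.

Lemma me_scale0 s t (f : hom s t) : 0%R *: f =m 0.
Proof.
have E : f + - f =m 1%R *: f + - f by rewrite me_scale1.
by rewrite -(me_subff delta R f) E -me_scaleDl subrr.
Qed.

Lemma me_scaler0 s t k : k *: (0 : hom s t) =m 0.
Proof. by rewrite -{1}(me_scale0 0) me_scaleA mulr0; apply: me_scale0. Qed.

Lemma me_comp0 s t u (g : hom t u) : g \bo (0 : hom s t) =m 0.
Proof. by rewrite -{1}(me_scale0 0) me_compZr; apply: me_scale0. Qed.

Lemma me_addACA s t (a b c d : hom s t) : a + b + (c + d) =m a + c + (b + d).
Proof.
by rewrite !me_addA -(me_addA _ _ a b c) (me_addC _ _ b c) me_addA.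
Qed.

Lemma me_addK s t (f g : hom s t) : f - g + g =m f.
Proof.
by rewrite -me_addA (me_addC _ _ (- g)) me_subff me_addr0.
Qed.

Lemma me_subr0 s t (f : hom s t) : f - 0 =m f.
Proof. by rewrite me_scaler0 me_addr0. Qed.

Lemma me_sub_eq0 s t (f g : hom s t) : f - g =m 0 -> f =m g.
Proof. by move=> fg; rewrite -(me_addK f g) fg me_add0. Qed.
End Linear.

(** * The quotient by the tensor ideal as a congruence *)

Section Hat.
Variables (K : fieldType) (M : finType) (v : M) (delta : K).
Local Notation hom := (mor K v).
Local Open Scope mor_scope.
Local Notation "f =hb g" := (mon_eq delta (@hb_rel K M v) f g) (at level 70).
Local Notation ideal := (tensor_ideal delta (@hat_gen K M v)).

(** Adding the generators of the ideal to the defining relations gives a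
    congruence for which all calculation rules hold by construction, so that
    one never handles elements of the ideal. *)
Inductive hat_rel : forall s t, hom s t -> hom s t -> Prop :=
  | hat_hb s t (f g : hom s t) : hb_rel f g -> hat_rel f g
  | hat_gen0 s t (f : hom s t) : hat_gen f -> hat_rel f 0.

Lemma hat_of_hb s t (f g : hom s t) : f =hb g -> hat_eq delta f g.
Proof.
move=> fg; apply: ideal_eq (ideal_zero _ _ _ _).
by rewrite /hb_eq fg me_subff.
Qed.

Lemma hat_trans s t (f g h : hom s t) :
  hat_eq delta f g -> hat_eq delta g h -> hat_eq delta f h.
Proof.
move=> fg gh; apply: ideal_eq (ideal_add fg gh).
by rewrite /hb_eq me_addA me_addK.
Qed.

(** A tensor ideal is closed under all operations, so equality modulo the ideal
    is a monoidal congruence, and it contains the least one generated by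
    [hat_rel]. *)
Lemma hat_eq_of_mon s t (f g : hom s t) :
  mon_eq delta hat_rel f g -> hat_eq delta f g.
Proof.
have N s' t' (a : hom s' t') : - - a =hb a.
  by rewrite me_scaleA mulrNN mulr1 me_scale1.
elim=> {s t f g}; try by move=> *; apply: hat_of_hb; constructor.
- move=> s t _ _ [{}s {}t f g fg|{}s {}t f Gf]; first exact/hat_of_hb/me_rel.
  by apply: ideal_eq (ideal_gen _ Gf); rewrite /hb_eq me_subr0.
- move=> s t f g _ fg; apply: ideal_eq (ideal_scale (-1) fg).
  by rewrite /hb_eq me_scaleDr N me_addC.
- move=> s t f g h _ fg _; exact: hat_trans.
  (* g f - g' f' = (g - g') f + g' (f - f') *)
- move=> s t u g g' f f' _ gg _ ff; apply: (@hat_trans _ _ _ (g' \bo f)).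
    apply: ideal_eq (ideal_comp_right f gg).
    by rewrite /hb_eq me_compDl me_compZl.
  apply: ideal_eq (ideal_comp_left g' ff).
  by rewrite /hb_eq me_compDr me_compZr.
- move=> s t s' t' f f' g g' _ ff _ gg; apply: (@hat_trans _ _ _ (f' \ox g)).
    apply: ideal_eq (ideal_tens_right g ff).
    by rewrite /hb_eq me_tensDl me_tensZl.
  apply: ideal_eq (ideal_tens_left f' gg).
  by rewrite /hb_eq me_tensDr me_tensZr.
- move=> s t f f' g g' _ ff _ gg; apply: ideal_eq (ideal_add ff gg).
  by rewrite /hb_eq me_addACA me_scaleDr.
- move=> s t k f f' _ ff; apply: ideal_eq (ideal_scale k ff).
  by rewrite /hb_eq me_scaleDr !me_scaleA mulrN1 mulN1r.
Qed.
End Hat.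

(** * Evaluation of Brauer words *)

Section Evaluation.
Variables (K : fieldType) (M : finType) (v : M) (delta : K).
Variable R : forall s t, mor K v s t -> mor K v s t -> Prop.
Implicit Types s t u : seq M.
Local Notation hom := (mor K v).
Local Open Scope mor_scope.
Local Notation "f =m g" := (mon_eq delta R f g) (at level 70).

(** Only words whose evaluation closes no loop are covered: their value is a
    diagram with coefficient 1. *)
Definition evaluates s t (f : hom s t) (ta : seq nat) : Prop :=
  exists2 D, f =m Diag K D & tabulates ta D.

(** A table determines a diagram, so an identity between Brauer words reduces
    to the equality of two computed lists of numbers. *)
Lemma evaluates_eq s t (f g : hom s t) ta :
  evaluates f ta -> evaluates g ta -> f =m g.
Proof.
by case=> D fD HD [D' gD HD']; rewrite fD gD (tabulates_inj HD HD').
Qed.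

Lemma evaluates_id s : evaluates (idm K v s) (id_table (size s)).
Proof. by exists (id_diagram v s) => //; apply: tabulates_id. Qed.

Lemma evaluates_cross s t :
  evaluates (crossm K v s t) (cross_table (size s) (size t)).
Proof. by exists (cross_diagram v s t) => //; apply: tabulates_cross. Qed.

Lemma evaluates_cap : evaluates (Diag K (cap_diagram v)) [:: 1%N; 0%N].
Proof. by exists (cap_diagram v) => //; apply: tabulates_cap. Qed.

Lemma evaluates_cup : evaluates (Diag K (cup_diagram v)) [:: 1%N; 0%N].
Proof. by exists (cup_diagram v) => //; apply: tabulates_cup. Qed.

Lemma evaluates_tens s t s' t' (f : hom s t) (g : hom s' t') ta tb :
  evaluates f ta -> evaluates g tb ->
  evaluates (f \ox g)
            (juxtapose_table (size s) (size t) (size s') (size t') ta tb).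
Proof.
case=> D fD HD [D' gD HD']; exists (juxtapose D D').
  by rewrite fD gD me_juxtapose.
exact: tabulates_juxtapose.
Qed.

Lemma evaluates_comp s t u (f : hom s t) (g : hom t u) ta tb :
  evaluates g tb -> evaluates f ta ->
  no_loop (size s) (size t) (size u) tb ta ->
  evaluates (g \bo f) (stack_table (size s) (size t) (size u) tb ta).
Proof.
case=> D gD HD [D' fD HD'] nl; exists (stack D D').
  by rewrite fD gD me_stack (loops0 HD HD' nl) expr0 me_scale1.
exact: tabulates_stack.
Qed.

Lemma evaluates_eq_table s t (f : hom s t) ta tb :
  evaluates f ta -> ta = tb -> evaluates f tb.
Proof. by move=> ? <-. Qed.
End Evaluation.

Ltac evaluate :=
  lazymatch goal with
  | |- @evaluates ?K ?M ?v ?d ?R _ _ ?f _ =>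
    lazymatch f with
    | idm _ _ ?s => exact (@evaluates_id K M v d R s)
    | crossm _ _ ?s ?t => exact (@evaluates_cross K M v d R s t)
    | Diag _ (cap_diagram _) => exact (@evaluates_cap K M v d R)
    | Diag _ (cup_diagram _) => exact (@evaluates_cup K M v d R)
    | @Tens _ _ _ ?s ?t ?s' ?t' ?f ?g =>
      refine (evaluates_eq_table
                (@evaluates_tens K M v d R s t s' t' f g _ _ _ _) _);
      [evaluate | evaluate | vm_compute; reflexivity]
    | @Comp _ _ _ ?s ?t ?u ?g ?f =>
      refine (evaluates_eq_table
                (@evaluates_comp K M v d R s t u f g _ _ _ _ _) _);
      [evaluate | evaluate | vm_compute; reflexivity | vm_compute; reflexivity]
    end
  end.

Ltac brauer := eapply evaluates_eq; [evaluate | evaluate].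

Section SmallDiagrams.
Variables (K : fieldType) (M : finType) (v : M) (delta : K).
Variable R : forall s t, mor K v s t -> mor K v s t -> Prop.
Local Notation hom := (mor K v).
Local Open Scope mor_scope.
Local Notation "f =m g" := (mon_eq delta R f g) (at level 70).
Local Notation I1 := (idm K v [:: v]).
Local Notation X := (crossm K v [:: v] [:: v]).
Local Notation cap := (Diag K (cap_diagram v)).
Local Notation cup := (Diag K (cup_diagram v)).

(** Turning the first strand of an endomorphism of [v^2] upside down; on the
    four end points this exchanges the first input with the first output. *)
Definition flip_first (f : hom [:: v; v] [:: v; v]) : hom [:: v; v] [:: v; v] :=
  (I1 \ox cap \ox I1) \bo (X \ox f) \bo (I1 \ox cup \ox I1).

Lemma zigzag : (cap \ox I1 : hom [:: v; v; v] [:: v]) \bo (I1 \ox cup) =m I1.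
Proof. brauer. Qed.

Lemma flip_X : flip_first X =m cup \bo cap.
Proof. rewrite /flip_first. brauer. Qed.

Lemma flip_E : flip_first (cup \bo cap) =m X.
Proof. rewrite /flip_first. brauer. Qed.

Lemma flip_I : flip_first (I1 \ox I1) =m I1 \ox I1.
Proof. rewrite /flip_first. brauer. Qed.

Lemma Xcup : X \bo cup =m cup.
Proof. brauer. Qed.

Lemma cap_cup : cap \bo cup =m delta *: idm K v [::].
Proof.
rewrite me_stack.
have -> : stack (cap_diagram v) (cup_diagram v) = id_diagram v [::].
  by apply/val_inj/ffunP; case=> [[]|[]].
suff -> : loops (cap_diagram v) (cup_diagram v) = 1%N by rewrite expr1.
(* All the glued points form one component. *)
pose x : glued [::] [:: v; v] [::] := inl (inr ord0).
rewrite -(n_comp_connect (glue_sym (cap_diagram v) (cup_diagram v)) x).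
apply: eq_n_comp_r => y; rewrite !inE.
have -> : connect (glue (cap_diagram v) (cup_diagram v)) x y.
  case: y => [[[]//|[[|[|//]] lt_j]]|[]//].
    rewrite (_ : inl _ = x) ?connect0 //.
    by congr (inl (inr _)); apply: val_inj.
  apply: connect1; apply/orP; left; rewrite /= ffunE /low_pt.
  by apply/eqP; congr (inl (inr _)); apply: val_inj.
by apply/forallP; case=> [[]|[]].
Qed.
End SmallDiagrams.

(** * Moving coupons *)

Section Monoidal.
Variables (K : fieldType) (M : finType) (v : M) (delta : K).
Variable R : forall s t, mor K v s t -> mor K v s t -> Prop.
Implicit Types s t u : seq M.
Local Notation hom := (mor K v).
Local Open Scope mor_scope.
Local Notation "f =m g" := (mon_eq delta R f g) (at level 70).
Local Notation I3 := (idm K v [:: v; v; v]).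
Local Notation ω := (@Omega K M v).

(** The casts of the strictness axioms disappear between objects whose lists of
    colours are convertible, which is the case whenever they are explicit. *)
Lemma castm_id s t (es : s = s) (et : t = t) (f : hom s t) : castm es et f = f.
Proof. by rewrite (eq_axiomK es) (eq_axiomK et). Qed.

Lemma comp_tens_id s t u c (g : hom t u) (f : hom s t) :
  (g \bo f) \ox idm K v c =m (g \ox idm K v c) \bo (f \ox idm K v c).
Proof. by rewrite -me_interchange me_id_comp. Qed.

Lemma id_tens_comp s t u c (g : hom t u) (f : hom s t) :
  idm K v c \ox (g \bo f) =m (idm K v c \ox g) \bo (idm K v c \ox f).
Proof. by rewrite -me_interchange me_id_comp. Qed.

Lemma tens_state s t (f : hom [::] s) (g : hom [::] t) :
  (f \ox idm K v t) \bo g =m f \ox g.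
Proof.
by rewrite -{2}(me_comp_id delta R f) -{2}(me_id_comp delta R g)
  me_interchange me_tens0l.
Qed.

(** With [tens_state], this lets a Brauer word without inputs pass from below
    the coupon to above it. *)
Lemma omega_tens t (g : hom [::] t) : (I3 \ox g) \bo ω =m ω \ox g.
Proof.
have E : ω \ox idm K v [::] =m ω.
  by have := me_tens0r delta R ω; rewrite castm_id.
by rewrite -{2}(me_id_comp delta R ω) -{2}(me_comp_id delta R g)
  me_interchange E.
Qed.

Lemma omega_tensA s c :
  (ω \ox idm K v s) \ox idm K v c =m ω \ox idm K v (s ++ c).
Proof.
have := me_tensA delta R ω (idm K v s) (idm K v c); rewrite castm_id => <-.
by rewrite me_tens_id.
Qed.
End Monoidal.

(** * The vector product identity and the dimension *)

Section Main.
Variables (K : fieldType) (M : finType) (v : M) (delta : K).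
Implicit Types s t u : seq M.
Local Notation hom := (mor K v).
Local Open Scope mor_scope.
Local Notation R := (@hat_rel K M v).
Local Notation "f =m g" := (mon_eq delta R f g) (at level 70).
Local Notation I1 := (idm K v [:: v]).
Local Notation I2 := (idm K v [:: v; v]).
Local Notation I3 := (idm K v [:: v; v; v]).
Local Notation I4 := (idm K v [:: v; v; v; v]).
Local Notation X := (crossm K v [:: v] [:: v]).
Local Notation slide := (crossm K v [:: v; v; v] [:: v; v]).
Local Notation cap := (Diag K (cap_diagram v)).
Local Notation cup := (Diag K (cup_diagram v)).
Local Notation ω := (@Omega K M v).
Local Notation U := (@Upsilon K M v).
Local Notation U' := (@hatUpsilon K M v).

Lemma hat_mon_of_hb s t (f g : hom s t) : hb_rel f g -> f =m g.
Proof. by move=> fg; apply: me_rel; constructor. Qed.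

Lemma omega_alt_left : (X \ox I1) \bo ω =m - ω.
Proof. exact/hat_mon_of_hb/rel_alt_left. Qed.

Lemma omega_alt_right : (I1 \ox X) \bo ω =m - ω.
Proof. exact/hat_mon_of_hb/rel_alt_right. Qed.

(** Sliding brings every coupon to the far left, where Brauer words can be
    collected above it. *)
Lemma slide_omega : I2 \ox ω =m slide \bo (ω \ox I2).
Proof.
have E : crossm K v [::] [:: v; v] =m I2 by brauer.
have := hat_mon_of_hb (rel_slide_right [:: v; v] (coupon_Omega K v)).
by rewrite E me_comp_id => ->.
Qed.

Lemma slide_omega_tens c :
  I2 \ox (ω \ox idm K v c) =m
  (slide \ox idm K v c) \bo (ω \ox idm K v [:: v, v & c]).
Proof.
have := me_tensA delta R I2 ω (idm K v c); rewrite castm_id => ->.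
by rewrite slide_omega comp_tens_id omega_tensA.
Qed.

Lemma Upsilon_tens c :
  U \ox idm K v c =m
  (I1 \ox I1 \ox cap \ox idm K v c) \bo (ω \ox idm K v (v :: c)).
Proof. by rewrite /Upsilon comp_tens_id omega_tensA. Qed.

Lemma hatUpsilon_tens c :
  U' \ox idm K v c =m
  (((I1 \ox cap) \bo (I1 \ox I1 \ox cap \ox I1)) \ox idm K v c)
    \bo (ω \ox idm K v [:: v, v & c]).
Proof.
rewrite -(omega_tensA delta R [:: v; v] c).
apply: me_trans (comp_tens_id _ _ _ _ _).
by rewrite /hatUpsilon Upsilon_tens me_compA.
Qed.

Lemma tens_Upsilon :
  I2 \ox U =m (I2 \ox (I1 \ox I1 \ox cap)) \bo (slide \ox I1) \bo (ω \ox I3).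
Proof. by rewrite /Upsilon id_tens_comp slide_omega_tens me_compA. Qed.

Lemma tens_hatUpsilon :
  I2 \ox U' =m
  (I2 \ox ((I1 \ox cap) \bo (I1 \ox I1 \ox cap \ox I1)))
    \bo (slide \ox I2) \bo (ω \ox I4).
Proof.
by rewrite /hatUpsilon Upsilon_tens me_compA (id_tens_comp _ _ _ _ (ω \ox I2))
  slide_omega_tens me_compA.
Qed.

(** Bending the input of [Upsilon] back up undoes the bending in its
    definition. *)
Lemma Upsilon_cup : (U \ox I1) \bo cup =m ω.
Proof.
have E : (I1 \ox I1 \ox cap \ox I1) \bo (I3 \ox cup) =m I3 by brauer.
by rewrite Upsilon_tens -me_compA (tens_state delta R ω cup) -omega_tens
  me_compA E me_id_comp.
Qed.

Lemma hatUpsilon_cup : U' \bo cup =m (I1 \ox cap) \bo ω.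
Proof. by rewrite -me_compA Upsilon_cup. Qed.

(** Crossing the two contracted legs costs a sign but does not change the cap.
    In characteristic 2 this says nothing, so the contraction cannot be set to
    zero here. *)
Lemma hatUpsilon_cup_opp : U' \bo cup =m - (U' \bo cup).
Proof.
have E : I1 \ox cap =m (I1 \ox cap) \bo (I1 \ox X) by brauer.
by rewrite hatUpsilon_cup {1}E -me_compA omega_alt_right me_compZr.
Qed.

Lemma bubble : U' \bo U =m 6%:R *: I1.
Proof. exact/me_sub_eq0/me_rel/hat_gen0/gen_bubble. Qed.

Local Notation cup2 := ((I1 \ox cup \ox I1) \bo cup).
Local Notation mid := (I1 \ox cap \ox I1).
Local Notation ωω := (ω \ox ω).

(** The two coupons are permuted by a transposition each, so the signs cancel;
    on the second one it is the transposition of the outer legs. *)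
Lemma omega2_alt :
  ((X \ox I1) \ox ((X \ox I1) \bo (I1 \ox X) \bo (X \ox I1))) \bo ωω
  =m ωω.
Proof.
rewrite -me_interchange omega_alt_left -!me_compA omega_alt_left.
rewrite !me_compZr omega_alt_right !me_compZr omega_alt_left !me_scaleA.
by rewrite me_tensZl me_tensZr me_scaleA !(mulN1r, mulrN1, opprK) me_scale1.
Qed.

(** This is the bubble relation with its input bent up. *)
Lemma double_edge_left :
  ((((I1 \ox cap) \bo (I1 \ox I1 \ox cap \ox I1)) \ox I1)) \bo ωω
  =m 6%:R *: cup.
Proof.
have -> : 6%:R *: cup =m ((6%:R *: I1) \ox I1) \bo cup.
  by rewrite me_tensZl me_compZl me_tens_id me_id_comp.
by rewrite -bubble (comp_tens_id _ _ _ U' U) -me_compA Upsilon_cup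
  hatUpsilon_tens -me_compA (tens_state delta R ω ω).
Qed.

(** Both ways of joining two coupons along two pairs of legs give the same
    value: up to the symmetry of the cup, they differ by the even symmetry of
    [omega2_alt]. *)
Lemma double_edge_right : mid \bo (I2 \ox U) \bo ω =m 6%:R *: cup.
Proof.
rewrite tens_Upsilon me_compA -me_compA (tens_state delta R ω ω).
have -> : 6%:R *: cup =m X \bo (6%:R *: cup).
  by rewrite me_compZr Xcup.
rewrite -double_edge_left -[in X in _ =m X]omega2_alt !me_compA.
apply: me_Comp => //.
brauer.
Qed.

(** Contracting with nested cups recovers the coupon with its legs permuted
    cyclically, an even permutation. *)
Lemma hatUpsilon_cup2 : (I2 \ox U') \bo cup2 =m ω.
Proof.
have slide_cup2 : (ω \ox I4) \bo cup2 =m (I3 \ox cup2) \bo ω.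
  transitivity (ω \ox cup2); first exact: tens_state.
  by symmetry; apply: omega_tens.
have cycle : (I2 \ox ((I1 \ox cap) \bo (I1 \ox I1 \ox cap \ox I1)))
    \bo (slide \ox I2) \bo (I3 \ox cup2) =m (I1 \ox X) \bo (X \ox I1).
  by brauer.
rewrite tens_hatUpsilon -(me_compA delta R _ (ω \ox I4) cup2).
rewrite slide_cup2 me_compA cycle.
rewrite -me_compA omega_alt_left me_compZr omega_alt_right me_scaleA.
by rewrite mulrNN mulr1 me_scale1.
Qed.

Local Notation flip := (@flip_first K M v).

Lemma cross_tens_Upsilon_hatUpsilon :
  X \ox (U \bo U') =m (I2 \ox U) \bo (X \ox I1) \bo (I2 \ox U').
Proof.
transitivity ((X \ox U) \bo (I2 \ox U')).
  by rewrite -me_interchange me_comp_id.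
apply: me_Comp => //.
by rewrite -me_interchange me_comp_id me_id_comp.
Qed.

Lemma flip_Upsilon_hatUpsilon : flip (U \bo U') \bo cup =m (- 6%:R)%R *: cup.
Proof.
rewrite /flip_first cross_tens_Upsilon_hatUpsilon -!me_compA.
rewrite hatUpsilon_cup2 omega_alt_left !me_compZr.
by rewrite me_compA double_edge_right me_scaleA mulN1r.
Qed.

(** The failure of [f] to be skew under the flip, seen through the cup; it is
    linear in [f] and vanishes on the coupon [HH v v]. *)
Definition skew_defect f := flip f \bo cup + f \bo cup.

Lemma skew_defectD f g : skew_defect (f + g) =m skew_defect f + skew_defect g.
Proof.
by rewrite /skew_defect /flip_first me_tensDr me_compDr !me_compDl me_addACA.
Qed.

Lemma skew_defectZ k f : skew_defect (k *: f) =m k *: skew_defect f.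
Proof.
by rewrite /skew_defect /flip_first me_tensZr me_compZr !me_compZl me_scaleDr.
Qed.

Lemma skew_defect_HH : skew_defect (HH v v) =m 0.
Proof.
have skew : flip (HH v v) =m - HH v v by exact/hat_mon_of_hb/rel_skew_left.
by rewrite /skew_defect skew me_addC me_compZl me_subff.
Qed.

Lemma skew_defect_X : skew_defect X =m (delta + 1)%R *: cup.
Proof.
rewrite /skew_defect flip_X -me_compA cap_cup me_compZr me_comp_id Xcup.
by rewrite me_scaleDl me_scale1.
Qed.

Lemma skew_defect_E : skew_defect (cup \bo cap) =m (delta + 1)%R *: cup.
Proof.
rewrite /skew_defect flip_E -me_compA cap_cup me_compZr me_comp_id Xcup me_addC.
by rewrite me_scaleDl me_scale1.
Qed.

Lemma skew_defect_I : skew_defect (I1 \ox I1) =m 2%:R *: cup.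
Proof.
rewrite /skew_defect flip_I me_tens_id me_id_comp mulr2n.
by rewrite me_scaleDl me_scale1.
Qed.

(** This is where the bubble relation and the loop value meet: all terms of
    the expansion of [HH v v] but one become multiples of the cup. *)
Lemma Upsilon_hatUpsilon_cup : U \bo (U' \bo cup) =m (7%:R - delta)%R *: cup.
Proof.
have : skew_defect (HH v v - X + 2%:R *: (cup \bo cap) - I1 \ox I1
                    + U \bo U') =m 0.
  have gen0 : HH v v - X + 2%:R *: (cup \bo cap) - I1 \ox I1 + U \bo U' =m 0.
    exact/me_rel/hat_gen0/gen_H.
  by rewrite /skew_defect /flip_first gen0 -(me_scale0 delta R 0) me_tensZr
    me_compZr !me_compZl -me_scaleDr me_scale0.
rewrite !skew_defectD !skew_defectZ skew_defect_HH skew_defect_X.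
rewrite skew_defect_E skew_defect_I.
rewrite /skew_defect flip_Upsilon_hatUpsilon !me_scaleA me_add0 me_addA.
rewrite -!me_scaleDl -me_compA.
set k := (X in X *: _ + _) => k_w.
rewrite -(me_add0 delta R (U \bo _)) -(me_subff delta R (k *: cup)).
rewrite -me_addA (me_addC _ _ (- _)) me_addA k_w me_add0 me_scaleA.
by rewrite (_ : (-1 * k = 7%:R - delta)%R) // /k; ring.
Qed.

Lemma two_hatUpsilon_cup : 2%:R *: (U' \bo cup) =m 0.
Proof.
by rewrite mulr2n me_scaleDl me_scale1 {2}hatUpsilon_cup_opp me_subff.
Qed.

(** Composing [Upsilon_hatUpsilon_cup] with [hatUpsilon] shows that [7 - delta]
    annihilates the contraction, because [6 = 3 * 2] does; composing with
    [Upsilon] again brings back the cup. *)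
Lemma scaled_cup_eq0 : ((7%:R - delta) * (7%:R - delta))%R *: cup =m 0.
Proof.
have u0 : (7%:R - delta)%R *: (U' \bo cup) =m 0.
  rewrite -me_compZr -Upsilon_hatUpsilon_cup me_compA bubble.
  rewrite me_compZl me_id_comp.
  have -> : (6%:R = 3%:R * 2%:R :> K)%R by rewrite -natrM.
  by rewrite -me_scaleA two_hatUpsilon_cup me_scaler0.
by rewrite -me_scaleA -Upsilon_hatUpsilon_cup -me_compZr u0 me_comp0.
Qed.

Lemma id_eq0 : delta != 7%:R -> I1 =m 0.
Proof.
move=> d7; have {}d7 : (7%:R - delta)%R != 0%R by rewrite subr_eq0 eq_sym.
have cup0 : cup =m 0.
  have d77 := mulf_neq0 d7 d7.
  rewrite -(me_scale1 delta R cup) -(mulVf d77) -me_scaleA scaled_cup_eq0.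
  exact: me_scaler0.
rewrite -(zigzag delta R) cup0 -(me_scale0 delta R 0) me_tensZr me_compZr.
by rewrite me_scale0.
Qed.
End Main.

Theorem lemma4p3 (K : fieldType) (delta : K) (M : finType) (v : M) :
  ~ hat_eq delta (idm K v [:: v]) Zero -> delta = 7%:R.
Proof.
move=> I_neq0; apply/eqP/negPn/negP => /(id_eq0 v) I0.
exact/I_neq0/hat_eq_of_mon.
Qed.
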